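(* Let $F_0$ be a continuous cumulative distribution function on $\mathbb{R}$, let $q$ be an EFKP upper-class function of a Brownian bridge, and let $\alpha\in(0,1)$. Let $X_1,X_2,\ldots$ be independent identically distributed random variables with a (fixed, not depending on $n$) continuous cumulative distribution function $F$, let $\mathbb{F}_n(t)=n^{-1}\sum_{i=1}^n\mathbb{I}(X_i\leq t)$, and define $$T_n(q)=\sup_{0<F_0(t)<1}\frac{\sqrt{n}\,|\mathbb{F}_n(t)-F_0(t)|}{q(F_0(t))},\qquad T_n^+(q)=\sup_{0<F_0(t)<1}\frac{\sqrt{n}\,(\mathbb{F}_n(t)-F_0(t))}{q(F_0(t))}.$$ Let $t_\alpha(q)$ and $t_\alpha^+(q)$ be real numbers with $\mathbf{P}\left(\sup_{0<u<1}|B(u)|/q(u)\geq t_\alpha(q)\right)=\alpha$ and $\mathbf{P}\left(\sup_{0<u<1}B(u)/q(u)\geq t^+_\alpha(q)\right)=\alpha$, where $\{B(u),0\leq u\leq 1\}$ is a Brownian bridge. Then the tests of $H_0:F=F_0$ based on $T_n(q)$ and $T_n^+(q)$ are consistent against the alternatives $F\neq F_0$ and $F>F_0$, respectively; that is: (i) if $F\neq F_0$, then $\mathbf{P}\left(T_n(q)>t_\alpha(q)\right)\to 1$ as $n\to\infty$; (ii) if $F>F_0$ (meaning $F(t)\geq F_0(t)$ for all $t\in\mathbb{R}$ and $F\neq F_0$), then $\mathbf{P}\left(T_n^+(q)>t^+_\alpha(q)\right)\to 1$ as $n\to\infty$.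
   Context: A function $w$ on $(0,1)$ is called strictly positive if $\inf_{\varepsilon\leq u\leq 1-\varepsilon}w(u)>0$ for all $0<\varepsilon<1/2$. Let $q$ be a strictly positive function on $(0,1)$ with $q(u)=q(1-u)$ for $u\in(0,1/2)$, which is nondecreasing in a neighborhood of zero and nonincreasing in a neighborhood of one. Such a $q$ is called an Erdős–Feller–Kolmogorov–Petrovski (EFKP) upper-class function of a Brownian bridge $\{B(u),0\leq u\leq 1\}$ if there exists a constant $0\leq b<\infty$ such that $\limsup_{u\to 0}|B(u)|/q(u)=b$ almost surely. The function $q$ need not be continuous. The suprema in $T_n(q)$ and $T_n^+(q)$ are over all $t\in\mathbb{R}$ with $0<F_0(t)<1$. $\mathbb{I}(A)$ denotes the indicator of the event $A$. *)

(* Defs.v *)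
From HB Require Import structures.
From mathcomp Require Import all_boot all_order all_algebra finmap.
From mathcomp Require Import all_classical all_reals all_analysis.

Set Implicit Arguments.
Unset Strict Implicit.
Unset Printing Implicit Defensive.

Import Order.TTheory GRing.Theory Num.Theory.
Import numFieldNormedType.Exports.

Local Open Scope classical_set_scope.
Local Open Scope ring_scope.

Definition mutually_independent d (T : measurableType d) (R : realType)
    (P : probability T R) (I : choiceType) (X : I -> {RV P >-> R}) : Prop :=
  forall (J : {fset I}) (A : I -> set R), (forall i, measurable (A i)) ->
    P (\bigcap_(i in [set` J]) X i @^-1` A i) =
    (\prod_(i <- J) P (X i @^-1` A i))%E.

(* The degenerate case is separate because [normal_prob m 0] is not the point
   mass at [m] but the uniform law on [0, 1]. *)
Definition gaussian_law (R : realType) (mu : set R -> \bar R) : Prop :=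
  (exists m s : R, 0 < s /\
     forall A : set R, measurable A -> mu A = normal_prob m s A) \/
  (exists m : R, forall A : set R, measurable A -> mu A = \d_m A).

Definition gaussian_process_on d (T : measurableType d) (R : realType)
    (P : probability T R) (D : set R) (B : R -> {RV P >-> R}) : Prop :=
  forall (n : nat) (u : 'I_n -> R) (a : 'I_n -> R), (forall i, D (u i)) ->
    gaussian_law (pushforward P (fun w => \sum_(i < n) a i * B (u i) w)).

(* Only the values [B u] with [u] in [0, 1] are constrained. *)
Definition brownian_bridge d (T : measurableType d) (R : realType)
    (P : probability T R) (B : R -> {RV P >-> R}) : Prop :=
  [/\ gaussian_process_on `[0, 1] B,
      forall u : R, u \in `[0, 1] -> ('E_P[B u] = 0)%E,
      forall u v : R, u \in `[0, 1] -> v \in `[0, 1] ->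
        covariance P (B u) (B v) = (Num.min u v - u * v)%:E
    & forall w : T, {within `[0, 1], continuous (fun u : R => B u w)}].

(* Functions on (0, 1) are total functions [R -> R] whose values outside
   (0, 1) are never used. *)
Definition strictly_positive (R : realType) (f : R -> R) : Prop :=
  forall e : R, 0 < e < 1 / 2 ->
    (0 < ereal_inf [set (f u)%:E | u in [set u : R | (e <= u <= 1 - e)%R]])%E.

Definition efkp_upper_class d (T : measurableType d) (R : realType)
    (P : probability T R) (B : R -> {RV P >-> R}) (q : R -> R) : Prop :=
  [/\ strictly_positive q,
      forall u : R, 0 < u < 1 / 2 -> q u = q (1 - u),
      exists2 e : R, 0 < e < 1 &
        forall u v : R, 0 < u -> u <= v -> v < e -> q u <= q v,
      exists2 e : R, 0 < e < 1 &
        forall u v : R, 1 - e < u -> u <= v -> v < 1 -> q v <= q u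
    & exists2 b : R, 0 <= b &
        {ae P, forall w, limf_esup (fun u : R => (`|B u w| / q u)%:E) 0^'+
                         = b%:E}].

(* The sample [X_1, ..., X_n] is [X 0, ..., X n.-1]. *)
Definition ecdf d (T : measurableType d) (R : realType) (P : probability T R)
    (X : nat -> {RV P >-> R}) (n : nat) (w : T) (t : R) : R :=
  n%:R^-1 * \sum_(i < n) (X i w <= t)%R%:R.

(* The suprema are extended-real: they can be [+oo] with positive probability,
   since [q] may vanish at the endpoints of (0, 1). *)
Definition Tstat d (T : measurableType d) (R : realType) (P : probability T R)
    (F0 q : R -> R) (X : nat -> {RV P >-> R}) (n : nat) (w : T) : \bar R :=
  ereal_sup [set (Num.sqrt n%:R * `|ecdf X n w t - F0 t| / q (F0 t))%:E
            | t in [set t : R | 0 < F0 t < 1]].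

Definition Tstat_plus d (T : measurableType d) (R : realType)
    (P : probability T R) (F0 q : R -> R) (X : nat -> {RV P >-> R})
    (n : nat) (w : T) : \bar R :=
  ereal_sup [set (Num.sqrt n%:R * (ecdf X n w t - F0 t) / q (F0 t))%:E
            | t in [set t : R | 0 < F0 t < 1]].

Definition bridge_sup_abs d (T : measurableType d) (R : realType)
    (P : probability T R) (B : R -> {RV P >-> R}) (q : R -> R) (w : T) :=
  ereal_sup [set (`|B u w| / q u)%:E | u in [set u : R | 0 < u < 1]].

Definition bridge_sup d (T : measurableType d) (R : realType)
    (P : probability T R) (B : R -> {RV P >-> R}) (q : R -> R) (w : T) :=
  ereal_sup [set (B u w / q u)%:E | u in [set u : R | 0 < u < 1]].

(* Main.v *)
Require Import Defs.
From HB Require Import structures.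
From mathcomp Require Import all_boot all_order all_algebra finmap.
From mathcomp Require Import all_classical all_reals all_analysis measurable_realfun.
From mathcomp Require Import ring lra.

Set Implicit Arguments.
Unset Strict Implicit.
Unset Printing Implicit Defensive.

Import Order.TTheory GRing.Theory Num.Theory.
Import numFieldNormedType.Exports.

Local Open Scope classical_set_scope.
Local Open Scope ring_scope.

(* A point [t] with [0 < F0 t < 1] and [F t <> F0 t] exists by the intermediate
   value theorem, and at such a [t] the rescaled deviation of the empirical
   distribution function from [F0 t] tends to infinity in probability by
   Chebyshev's inequality, so it eventually exceeds any fixed critical value.

   As [q] is an arbitrary function, the measurability of the rejection event
   needs an argument: [q] only enters through sets [S] of times at which a given
   value of the empirical distribution function would lead to rejection.
   Sample paths are constant to the right of every point, so [S] may be replaced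
   by a countable subset that is dense in [S] for the topology of half-open
   intervals [t, y[ (the Sorgenfrey line is hereditarily separable). *)

(** * Measurability of suprema over uncountable sets of times *)

Lemma right_separable (R : realType) (S : set R) :
  exists f : rat * rat + rat -> R, forall t y, S t -> t < y ->
    exists u, S (f u) /\ t <= f u < y.
Proof.
(* Index [inl (p, r)] picks a point of [S] in ]p, r[; index [inr r] picks the largest point of [S]
   below [r]. The latter reaches a [t] in [S] that has no other point of [S] just to its right. The
   default 0 of [xget] is never reached below. *)
exists (fun u => match u with
  | inl pr => xget 0 (S `&` `]ratr pr.1, ratr pr.2[%classic)
  | inr r => xget 0 [set t | [/\ S t, t < ratr r &
                      forall s, S s -> s < ratr r -> s <= t]]
  end) => t y St ty.
have [r] := rat_in_itvoo ty; rewrite in_itv/= => /andP[tr ry].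
have [noS|] := pselect (forall s, S s -> s < ratr r -> s <= t).
  exists (inr r); case: xgetP => [s _ [Ss sr /(_ _ St tr) ts]|/(_ t)[]//].
  by rewrite ts (lt_trans sr ry).
move=> /existsNP[s] /not_implyP[Ss] /not_implyP[sr] /negP; rewrite -ltNge => ts.
have [p] := rat_in_itvoo ts; rewrite in_itv/= => /andP[tp ps].
exists (inl (p, r)); case: xgetP => [x _ [Sx]|/(_ s)[]] /=; last first.
  by split => //=; rewrite in_itv/= ps.
by rewrite in_itv/= => /andP[px xr]; rewrite (ltW (lt_trans tp px)) (lt_trans xr ry).
Qed.

(** Split according to the value [k] of [Z]. While [Z w] keeps the value [k] on [t, y[, the time [t]
    can be traded for a point of the countable family attached to [G^~ k], so the uncountable union
    becomes a countable one, whatever [G] is. *)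
Lemma measurable_exists_rstep d (T : measurableType d) (R : realType)
    (Z : T -> R -> nat) (G : R -> nat -> Prop) :
  (forall t k, measurable [set w | Z w t = k]) ->
  (forall w t, exists2 y, t < y & forall s, t <= s < y -> Z w s = Z w t) ->
  measurable [set w | exists t, G t (Z w t)].
Proof.
move=> mZ rZ; have [f fP] := choice (fun k => right_separable (G^~ k)).
rewrite [X in measurable X](_ : _ =
    \bigcup_k \bigcup_u [set w | G (f k u) k /\ Z w (f k u) = k]).
  apply: bigcupT_measurable => k; apply: countable_bigcupT_measurable => // u.
  have [Gk|nGk] := pselect (G (f k u) k).
    rewrite [X in measurable X](_ : _ = [set w | Z w (f k u) = k])//.
    by apply/seteqP; split => w //= -[].
  rewrite [X in measurable X](_ : _ = set0)//.
  by apply/seteqP; split => w //= -[].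
apply/seteqP; split => w /= [].
  move=> t Gt; have [y ty Zy] := rZ w t.
  have [u [Gu tuy]] := fP (Z w t) t y Gt ty.
  by exists (Z w t) => //; exists u => //=; rewrite Zy.
by move=> k _ [u _ /= [Gk Zk]]; exists (f k u); rewrite Zk.
Qed.

Section ecdf.
Context d (T : measurableType d) (R : realType) (P : probability T R).
Variable X : nat -> {RV P >-> R}.

Lemma measurable_RV_le (Y : {RV P >-> R}) (t : R) :
  measurable (Y @^-1` `]-oo, t]%classic).
Proof. exact: measurable_funPTI. Qed.

Lemma ecdf_indic n w t :
  ecdf X n w t = n%:R^-1 * (\sum_(i < n) \1_(X i @^-1` `]-oo, t]%classic)) w.
Proof.
rewrite /ecdf fct_sumE; congr (_ * _); apply: eq_bigr => i _.
by rewrite indicE /= -[_ \in _]/(X i w \in `]-oo, t]%classic) mem_setE in_itv.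
Qed.

Lemma measurable_ecdf n t : measurable_fun setT (fun w => ecdf X n w t).
Proof.
rewrite [X in measurable_fun _ X](_ : _ = fun w => n%:R^-1 *
    \sum_(i < n) \1_(X i @^-1` `]-oo, t]%classic) w); last first.
  by apply/funext => w; rewrite ecdf_indic fct_sumE.
apply: measurable_funM => //; apply: measurable_sum => i.
exact/measurable_indic/measurable_RV_le.
Qed.

Lemma count_le_rstep n w t : exists2 y, t < y & forall s, t <= s < y ->
  (\sum_(i < n) (X i w <= s)%R = \sum_(i < n) (X i w <= t)%R)%N.
Proof.
elim: n => [|n [y ty IH]];
  first by exists (t + 1); [lra|move=> s _; rewrite !big_ord0].
have [Xt|tX] := leP (X n w) t.
  exists y => // s /[dup] tsy /andP[ts _].
  by rewrite !big_ord_recr/= IH// Xt (le_trans Xt ts).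
(* An observation beyond [t] is not counted until it is reached. *)
exists (Num.min y (X n w)); first by rewrite lt_min ty tX.
move=> s /andP[ts]; rewrite lt_min => /andP[sy sX].
by rewrite !big_ord_recr/= IH ?ts// !leNgt sX tX.
Qed.

Lemma measurable_ecdf_sup n (D : set R) (g : R -> R -> R) (c : R) :
  measurable [set w | (c%:E <
    ereal_sup [set (g t (ecdf X n w t))%:E | t in D])%E].
Proof.
pose Z w t := (\sum_(i < n) (X i w <= t)%R)%N.
rewrite [X in measurable X](_ : _ = [set w | exists t,
    D t /\ c < g t (n%:R^-1 * (Z w t)%:R)]); last first.
  apply/seteqP; split => w /=.
    move=> /ereal_sup_gtP[_ [t Dt <-]]; rewrite lte_fin => ct.
    by exists t; rewrite /Z natr_sum.
  move=> [t [Dt ct]]; apply/ereal_sup_gtP.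
  by exists (g t (ecdf X n w t))%:E; [exists t|rewrite lte_fin /ecdf -natr_sum].
apply: (@measurable_exists_rstep _ _ _ Z
  (fun t k => D t /\ c < g t (n%:R^-1 * k%:R))).
  move=> t k.
  rewrite [X in measurable X](_ : _ =
      (fun w => n%:R * ecdf X n w t) @^-1` [set k%:R]).
    rewrite -[X in measurable X]setTI.
    have mnF : measurable_fun setT (fun w => n%:R * ecdf X n w t).
      by apply: measurable_funM => //; exact: measurable_ecdf.
    by apply: mnF => //; exact: measurable_set1.
  (* For [n = 0] the factor [n%:R^-1] cannot be cancelled, but the count and the rescaled ecdf are
     then both 0. *)
  apply/seteqP; split => w /=; rewrite /ecdf -natr_sum -/(Z w t).
    move=> <-; rewrite /Z; case: (n) => [|m]; first by rewrite !big_ord0 mul0r.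
    by rewrite mulVKf ?pnatr_eq0.
  rewrite /Z; case: (n) => [|m].
    by rewrite !big_ord0 mul0r => /eqP; rewrite eq_sym pnatr_eq0 => /eqP.
  by rewrite mulVKf ?pnatr_eq0// => /eqP; rewrite eqr_nat => /eqP.
by move=> w t; exact: count_le_rstep.
Qed.

End ecdf.

(** * Distribution functions and a point that separates them *)

Lemma cumulativeBounded_itv (R : realType) (l r : R)
    (f : cumulativeBounded l r) t : l <= f t <= r.
Proof.
apply/andP; split; rewrite leNgt; apply/negP => ft.
- have /filter_ex[x [xt]] : \forall x \near -oo, x <= t /\ f t < f x.
    by apply: filterI; [exact: nbhs_ninfty_le|exact: (cvgr_gt _ (cumulativeNy f) _ ft)].
  by rewrite ltNge (cumulative_is_nondecreasing f).
- have /filter_ex[x [tx]] : \forall x \near +oo, t <= x /\ f x < f t.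
    by apply: filterI; [exact: nbhs_pinfty_ge|exact: (cvgr_lt _ (cumulativey f) _ ft)].
  by rewrite ltNge (cumulative_is_nondecreasing f).
Qed.

Lemma cumulativeBounded_surj (R : realType) (l r : R)
    (f : cumulativeBounded l r) v :
  continuous (f : R -> R) -> l < v < r -> exists t, f t = v.
Proof.
move=> cf /andP[lv vr].
have /filter_ex[a fa] : \forall x \near -oo, f x < v
  by exact: (cvgr_lt _ (cumulativeNy f) _ lv).
have /filter_ex[b fb] : \forall x \near +oo, v < f x
  by exact: (cvgr_gt _ (cumulativey f) _ vr).
have ab : a <= b.
  rewrite leNgt; apply/negP => /ltW /(cumulative_is_nondecreasing f).
  by rewrite leNgt (lt_trans fa fb).
have [||c _ <-] := @IVT R f a b v ab; last by exists c.
  exact: continuous_subspaceT.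
by rewrite ge_min le_max (ltW fa) (ltW fb) orbT.
Qed.

(** If [F0 t0 = 0] at a point [t0] of disagreement, choose [t] with [F0 t] half of [F t0]: it lies
    to the right of [t0], so [F t >= F t0 > F0 t]. If [F0 t0 = 1], the midpoint of [F t0] and 1
    works symmetrically. *)
Lemma cumulativeBounded_neq (R : realType) (F F0 : cumulativeBounded (0 : R) (1 : R)) :
  continuous (F0 : R -> R) -> (F : R -> R) <> (F0 : R -> R) ->
  exists2 t, 0 < F0 t < 1 & F t != F0 t.
Proof.
move=> cF0 FF0; have [t0 ne0] : exists t, F t <> F0 t.
  by apply: contrapT => /forallNP h; apply: FF0; apply/funext => t; apply: contrapT.
have ltW_F0 s t : F0 s < F0 t -> s <= t.
  move=> h; rewrite leNgt; apply/negP => /ltW /(cumulative_is_nondecreasing F0).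
  by rewrite leNgt h.
have /andP[F00 F01] := cumulativeBounded_itv F0 t0.
have /andP[Fge0 Fle1] := cumulativeBounded_itv F t0.
have [z0|nz0] := eqVneq (F0 t0) 0.
  have Fgt0 : 0 < F t0 by rewrite lt_neqAle Fge0 andbT eq_sym; apply/eqP; rewrite -{2}z0.
  have [|t Et] := cumulativeBounded_surj (v := F t0 / 2) cF0; first by lra.
  exists t; first by lra.
  have ? : F t0 <= F t by apply/cumulative_is_nondecreasing/ltW_F0; lra.
  by rewrite gt_eqF//; lra.
have [z1|nz1] := eqVneq (F0 t0) 1.
  have Flt1 : F t0 < 1 by rewrite lt_neqAle Fle1 andbT; apply/eqP; rewrite -{2}z1.
  have [|t Et] := cumulativeBounded_surj (v := (1 + F t0) / 2) cF0; first by lra.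
  exists t; first by lra.
  have ? : F t <= F t0 by apply/cumulative_is_nondecreasing/ltW_F0; lra.
  by rewrite lt_eqF//; lra.
exists t0; last exact/eqP.
by rewrite !lt_neqAle eq_sym nz0 nz1 F00.
Qed.

(** * Variance of sums of uncorrelated indicators *)

Section weak_law.
Context d (T : measurableType d) (R : realType) (P : probability T R).

Lemma Lfun_indic (A : set T) (r : R) :
  r != 0 -> measurable A -> \1_A \in Lfun P r%:E.
Proof.
move=> r0 mA; rewrite inE; apply/andP; split; rewrite inE//=.
rewrite /finite_norm unlock poweR_lty//.
under eq_integral => x _.
  (* The exponent must be nonzero for 0 to be sent to 0. *)
  rewrite (_ : (_ `^ _)%E = (\1_A x)%:E); last first.
    rewrite /= indicE; case: (x \in A) => /=; rewrite ?normr1 ?normr0.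
      by rewrite powR1.
    by rewrite powR0.
  over.
by rewrite integral_indic// setIT (le_lt_trans (probability_le1 P mA)) ?ltry.
Qed.

Lemma covariance_indic_indep (A B : set T) : measurable A -> measurable B ->
  P (A `&` B) = (P A * P B)%E -> covariance P \1_A \1_B = 0%E.
Proof.
move=> mA mB PAB.
have AB : (\1_A * \1_B = \1_(A `&` B) :> (T -> R))%R by rewrite indicI.
rewrite covarianceE ?AB ?Lfun_indic ?oner_eq0//; last exact: measurableI.
rewrite !expectation_indic//; last exact: measurableI.
by rewrite PAB subee// fin_numM// fin_num_measure.
Qed.

Lemma variance_indic_le1 (A : set T) : measurable A -> ('V_P[\1_A] <= 1)%E.
Proof.
move=> mA; have AA : (\1_A * \1_A = \1_A :> (T -> R))%R.
  by rewrite -[LHS]/(\1_A \* \1_A) -indicI setIid.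
rewrite /variance covarianceE ?AA ?Lfun_indic ?oner_eq0// expectation_indic//.
apply: le_trans (probability_le1 P mA).
by rewrite leeBlDr ?leeDl ?mule_ge0// fin_numM// fin_num_measure.
Qed.

Lemma covariance_suml n (Y : nat -> T -> R) (Z : T -> R) :
  (forall i, Y i \in Lfun P 2%:E) -> Z \in Lfun P 2%:E ->
  covariance P (\sum_(i < n) Y i) Z = (\sum_(i < n) covariance P (Y i) Z)%E.
Proof.
move=> LY LZ; elim: n => [|n IH].
  by rewrite !big_ord0; exact: covariance_cst_l.
rewrite !big_ord_recr/= -IH; apply: covarianceDl => //.
by rewrite rpred_sum ?lee1n.
Qed.

Lemma variance_sum_uncorrelated n (Y : nat -> T -> R) :
  (forall i, Y i \in Lfun P 2%:E) ->
  (forall i j, i != j -> covariance P (Y i) (Y j) = 0%E) ->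
  ('V_P[(\sum_(i < n) Y i)%R] = \sum_(i < n) 'V_P[Y i])%E.
Proof.
move=> LY Y0; elim: n => [|n IH].
  by rewrite !big_ord0; exact: variance_cst.
rewrite !big_ord_recr/= -IH.
rewrite -[LHS]/('V_P[((\sum_(i < n) Y i)%R \+ Y n)%R]) varianceD//; last first.
  by rewrite rpred_sum ?lee1n.
rewrite covariance_suml// [X in (2%:E * X)%E]big1 ?mule0 ?adde0// => i _.
by rewrite Y0// neq_ltn ltn_ord.
Qed.

End weak_law.

(** * Consistency of tests based on the ecdf *)

Section ecdf_consistency.
Context d (T : measurableType d) (R : realType) (P : probability T R).
Variables (X : nat -> {RV P >-> R}) (F : R -> R).
Hypothesis Xindep : mutually_independent X.
Hypothesis Xlaw : forall (i : nat) (t : R), cdf (X i) t = (F t)%:E.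

Let A t i := X i @^-1` `]-oo, t]%classic.

Lemma uncorrelated_indic_le t i j : i != j ->
  covariance P \1_(A t i) \1_(A t j) = 0%E.
Proof.
move=> ij; apply: covariance_indic_indep; [exact: measurable_RV_le..|].
have := Xindep [fset i; j]%fset (fun=> measurable_itv `]-oo, t]).
rewrite big_fsetU1 ?inE// big_seq_fset1 => <-; congr (P _).
apply/seteqP; split => [w [Ai Aj] k /=|w /= h].
  by rewrite !inE => /orP[] /eqP ->.
by split; apply: (h _ _); rewrite /= !inE eqxx ?orbT.
Qed.

(** Chebyshev's inequality for the count [S] with threshold [n.+1%:R * e]: each of the [n.+1]
    uncorrelated indicators has variance at most 1. *)
Lemma ecdf_chebyshev n t (e : R) : 0 < e ->
  (P [set w | (e <= `|ecdf X n.+1 w t - F t|)%R] <=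
    ((n.+1%:R * e ^+ 2)^-1)%:E)%E.
Proof.
move=> e0; have mA i : measurable (A t i) by exact: measurable_RV_le.
set S := (\sum_(i < n.+1) \1_(A t i) : T -> R).
have LA i : \1_(A t i) \in Lfun P 2%:E.
  by rewrite Lfun_indic ?pnatr_eq0.
have LA1 i : \1_(A t i) \in Lfun P 1%:E.
  by rewrite Lfun_indic ?oner_eq0.
have LS : S \in Lfun P 2%:E by rewrite rpred_sum ?lee1n.
have ES : ('E_P[S])%E = (n.+1%:R * F t)%:E.
  rewrite /S; elim: n.+1 => [|m IH].
    by rewrite big_ord0 mul0r; exact: expectation_cst.
  rewrite big_ord_recr/=.
  rewrite -[LHS]/('E_P[(\sum_(i < m) \1_(A t i))%R \+ \1_(A t m)])%E.
  rewrite expectationD ?rpred_sum// IH expectation_indic//.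
  by rewrite -[P _]/(cdf (X m) t) Xlaw -EFinD -natr1 mulrDl mul1r.
have VS : ('V_P[S] <= n.+1%:R%:E)%E.
  rewrite /S (@variance_sum_uncorrelated _ _ _ P n.+1 (fun i => \1_(A t i)))//; last first.
    by move=> i j; exact: uncorrelated_indic_le.
  apply: (@le_trans _ _ (\sum_(i < n.+1) 1)%E).
    by apply: lee_sum => i _; exact: variance_indic_le1.
  by rewrite sumEFin sumr_const card_ord.
have mS : S \in mfun by case/andP: LS.
have := chebyshev (mfun_Sub mS : {RV P >-> R}) (eps := n.+1%:R * e).
rewrite mulr_gt0// => /(_ isT).
rewrite /= ES /=.
rewrite [X in (P X <= _)%E -> _](_ : _ =
    [set w | (e <= `|ecdf X n.+1 w t - F t|)%R]); last first.
  apply: eq_set => w.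
  have -> : S w - n.+1%:R * F t = n.+1%:R * (ecdf X n.+1 w t - F t).
    by rewrite ecdf_indic mulrBr mulVKf ?pnatr_eq0.
  by rewrite normrM normr_nat ler_pM2l.
move=> /le_trans; apply.
apply: (@le_trans _ _ (((n.+1%:R * e) ^- 2)%:E * n.+1%:R%:E)%E).
  by rewrite lee_pmul2l// lte_fin invr_gt0 exprn_gt0// mulr_gt0.
rewrite -EFinM lee_fin (_ : _ * _ = (n.+1%:R * e ^+ 2)^-1)//.
by move: n.+1%:R (pnatr_eq0 R n.+1) => N /negbT N0; field; rewrite N0 gt_eqF.
Qed.

(** One time [t] in [D] suffices to bound the supremum from below: for large [n], failing to reject
    forces the ecdf at [t] to be at least [e] away from [F t]. The function [g] lets the one-sided
    and two-sided statistics share the argument. *)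
Lemma ecdf_sup_test_consistent (D : set R) (g : nat -> R -> R -> R) (c e t : R) :
  D t -> 0 < e ->
  (\forall n \near \oo, forall x, `|x - F t| < e -> c < g n t x) ->
  P [set w | (c%:E < ereal_sup [set (g n s (ecdf X n w s))%:E | s in D])%E]
    @[n --> \oo] --> 1%E.
Proof.
move=> Dt e0 gc.
pose E n := [set w | (c%:E < ereal_sup [set (g n s (ecdf X n w s))%:E | s in D])%E].
have mE n : measurable (E n) := measurable_ecdf_sup X n D (g n) c.
(* The shift matches the sample size [n.+1] of the Chebyshev bound, which is
   [harmonic n / e ^+ 2]. *)
rewrite -(cvg_shiftS (P \o E))/=.
apply: (@squeeze_cvge _ _ _ _
    (fun n => (1 - (harmonic n / e ^+ 2)%:E)%E) _ (cst 1%E) _ 1%E); last 2 first.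
- rewrite -[X in _ --> X]sube0; apply: cvgeB => //; first exact: cvg_cst.
  apply: cvg_EFin; first by near=> n.
  by rewrite -[X in _ --> X](mul0r (e ^- 2)); apply: cvgMl; exact: cvg_harmonic.
- exact: cvg_cst.
have gcS : \forall n \near \oo, forall x, `|x - F t| < e -> c < g n.+1 t x.
  by case: gc => N _ gc; exists N => // n /= Nn; apply: gc => /=; exact: leqW.
near=> n; have gn : forall x, `|x - F t| < e -> c < g n.+1 t x.
  by near: n; exact: gcS.
rewrite probability_le1// andbT.
rewrite -[E _]setCK probability_setC; last exact: measurableC.
apply: leeB => //.
have -> : harmonic n / e ^+ 2 = (n.+1%:R * e ^+ 2)^-1
  by rewrite [RHS]invfM.
apply: le_trans (ecdf_chebyshev n t e0).
  apply: le_measure; rewrite ?inE; first exact: measurableC.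
    rewrite -[X in measurable X]setTI.
    apply: (measurable_fun_le (f := cst e)) => //.
    apply: measurableT_comp => //; apply: measurable_funB => //.
    exact: measurable_ecdf.
  move=> w /= nE; rewrite leNgt; apply/negP => lte; apply: nE.
  apply/ereal_sup_gtP; exists (g n.+1 t (ecdf X n.+1 w t))%:E; first by exists t.
  by rewrite lte_fin; exact: gn.
Unshelve. all: by end_near. Qed.

End ecdf_consistency.

(** * Positive weights, growing deviations and the two tests *)

Lemma strictly_positive_gt0 (R : realType) (f : R -> R) u :
  strictly_positive f -> 0 < u < 1 -> 0 < f u.
Proof.
move=> fpos /andP[u0 u1].
have m0 : 0 < Num.min u (1 - u) by rewrite lt_min u0 subr_gt0.
have mu : Num.min u (1 - u) <= u by rewrite ge_min lexx.
have mu' : Num.min u (1 - u) <= 1 - u by rewrite ge_min lexx orbT.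
(* Halving keeps the bound strict at [u = 1/2], where the minimum is itself 1/2. *)
have /fpos : 0 < Num.min u (1 - u) / 2 < 1 / 2 by lra.
rewrite -lte_fin => /lt_le_trans; apply; apply: ereal_inf_lbound.
by exists u => //=; lra.
Qed.

Lemma near_sqrtn_gt (R : realType) (a c : R) : 0 < a ->
  \forall n \near \oo, c < Num.sqrt n%:R * a.
Proof.
move=> a0; near=> n.
have : `|c / a| ^+ 2 < n%:R by near: n; exact: nbhs_infty_gtr.
rewrite -ltr_sqrt ?sqrtr_sqr ?normr_id => [h|]; last first.
  near: n; exact: nbhs_infty_gtr.
by rewrite -ltr_pdivrMr// (le_lt_trans (ler_norm _)).
Unshelve. all: by end_near. Qed.

Unset Implicit Arguments.

Theorem mainTheorem2 (R : realType)
  (d' : measure_display) (T' : measurableType d') (P' : probability T' R)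
  (B : R -> {RV P' >-> R}) (hB : brownian_bridge B)
  (q : R -> R) (hq : efkp_upper_class B q)
  (alpha : R) (halpha : 0 < alpha < 1)
  (ta tap : R)
  (hta : P' [set w | (ta%:E <= bridge_sup_abs B q w)%E] = alpha%:E)
  (htap : P' [set w | (tap%:E <= bridge_sup B q w)%E] = alpha%:E)
  (F0 F : cumulativeBounded (0 : R) (1 : R))
  (hF0 : continuous (F0 : R -> R)) (hF : continuous (F : R -> R))
  (d : measure_display) (T : measurableType d) (P : probability T R)
  (X : nat -> {RV P >-> R})
  (Xindep : mutually_independent X)
  (Xlaw : forall (i : nat) (t : R), cdf (X i) t = (F t)%:E) :
  ((F : R -> R) <> (F0 : R -> R) ->
     P [set w | (ta%:E < Tstat F0 q X n w)%E] @[n --> \oo] --> 1%E) /\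
  ((forall t : R, F0 t <= F t) -> (F : R -> R) <> (F0 : R -> R) ->
     P [set w | (tap%:E < Tstat_plus F0 q X n w)%E] @[n --> \oo] --> 1%E).
Proof.
have q0 u : 0 < u < 1 -> 0 < q u by case: hq => /strictly_positive_gt0 + _ _ _ _; exact.
split=> [FF0|leF0F FF0].
all: have [t F0t neFt] := cumulativeBounded_neq hF0 FF0.
all: have qt := q0 _ F0t.
(* Half the gap: an ecdf value within [e] of [F t] stays at distance at least [e] from [F0 t] by the
   triangle inequality. *)
- pose e := `|F t - F0 t| / 2.
  have e0 : 0 < e by rewrite divr_gt0// normr_gt0 subr_eq0.
  apply: (@ecdf_sup_test_consistent _ _ _ _ _ _ Xindep Xlaw _
    (fun n s x => Num.sqrt n%:R * `|x - F0 s| / q (F0 s)) ta e t) => //.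
  near=> n => x xF.
  have : ta < Num.sqrt n%:R * (e / q (F0 t)).
    by near: n; apply: near_sqrtn_gt; rewrite divr_gt0.
  move=> /lt_le_trans; apply; rewrite -mulrA ler_wpM2l// ler_pM2r ?invr_gt0//.
  have := ler_distD x (F t) (F0 t).
  by rewrite (distrC (F t) x); move: xF; rewrite /e; lra.
(* The ordering of [F0] and [F] makes the gap positive, so the signed deviation is itself at least
   [e]. *)
- pose e := (F t - F0 t) / 2.
  have e0 : 0 < e by rewrite divr_gt0// subr_gt0 lt_neqAle eq_sym neFt leF0F.
  apply: (@ecdf_sup_test_consistent _ _ _ _ _ _ Xindep Xlaw _
    (fun n s x => Num.sqrt n%:R * (x - F0 s) / q (F0 s)) tap e t) => //.
  near=> n => x xF.
  have : tap < Num.sqrt n%:R * (e / q (F0 t)).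
    by near: n; apply: near_sqrtn_gt; rewrite divr_gt0.
  move=> /lt_le_trans; apply; rewrite -mulrA ler_wpM2l// ler_pM2r ?invr_gt0//.
  by move: xF; rewrite ltr_distl /e; lra.
Unshelve. all: by end_near. Qed.
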